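(* For a locally convex space $E$ over the field $\mathbb{F}$ the following conditions are equivalent: (i) $E$ has the Josefson--Nissenzweig property (JNP); (ii) there exists a continuous linear operator $T:E\to C_p^0(\omega)$ which is not $\beta$-to-$\beta$ precompact.
   Context: All locally convex spaces (lcs) are over the field $\mathbb{F}$ of real or complex numbers, Hausdorff and infinite-dimensional. $E'$ is the topological dual of $E$. A barrel in an lcs $E$ is a closed absorbent absolutely convex subset. A set $B\subseteq E$ is barrel-bounded if for every barrel $U\subseteq E$ there is $n\in\mathbb{N}$ with $B\subseteq nU$. The topology $\beta^*(E',E)$ on $E'$ is the locally convex topology of uniform convergence on barrel-bounded subsets of $E$: a neighborhood base at zero is given by the polars $B^\circ=\{\chi\in E': |\chi(x)|\le 1 \text{ for all } x\in B\}$ of barrel-bounded sets $B\subseteq E$. $E'_{w^*}$ is $E'$ with the weak$^*$ topology $\sigma(E',E)$ and $E'_{\beta^*}$ is $E'$ with $\beta^*(E',E)$. The space $E$ has the Josefson--Nissenzweig property (JNP) if the identity map $E'_{w^*}\to E'_{\beta^*}$ is not sequentially continuous; equivalently, there is a sequence in $E'$ converging to $0$ in $\sigma(E',E)$ but not in $\beta^*(E',E)$. $C_p^0(\omega)$ denotes the subspace of the product $\mathbb{F}^\omega$ (with the product topology) consisting of all functions $\omega\to\mathbb{F}$ that tend to zero at infinity. A set $A$ in an lcs $Y$ is barrel-precompact if for every barrel $U\subseteq Y$ there is a finite set $F\subseteq Y$ with $A\subseteq F+U$ (i.e. $A$ is precompact in the locally convex topology on $Y$ whose neighborhood base at zero is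 formed by the barrels of $Y$). A continuous linear operator $T:X\to Y$ between lcs is $\beta$-to-$\beta$ precompact if for every barrel-bounded set $B\subseteq X$ the image $T(B)$ is barrel-precompact in $Y$. *)

(* Defs.v *)
From HB Require Import structures.
From mathcomp Require Import all_boot all_order all_algebra.
From mathcomp Require Import all_classical all_reals all_analysis.
From mathcomp Require Import complex.

Set Implicit Arguments.
Unset Strict Implicit.
Unset Printing Implicit Defensive.

Import Order.TTheory GRing.Theory Num.Theory.
Import numFieldNormedType.Exports.

Local Open Scope classical_set_scope.
Local Open Scope ring_scope.

(* Over the complex numbers the order on K is partial, and 0 < r forces r to be
   real; the coefficients in convex_set are likewise real. *)

Definition finite_dimensional (K : numFieldType) (E : lmodType K) : Prop :=
  exists (n : nat) (v : 'I_n -> E),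
    forall x, exists c : 'I_n -> K, x = \sum_(i < n) c i *: v i.

Section Barrels.
Context (K : numFieldType) (E : tvsType K).

Definition balanced (A : set E) : Prop :=
  forall a : K, `|a| <= 1 -> *:%R a @` A `<=` A.

Definition absolutely_convex (A : set E) : Prop :=
  convex_set A /\ balanced A.

Definition absorbent (A : set E) : Prop :=
  forall x : E, exists2 r : K, 0 < r &
    forall a : K, r <= `|a| -> ( *:%R a @` A) x.

Definition barrel (U : set E) : Prop :=
  [/\ closed U, absorbent U & absolutely_convex U].

Definition barrel_bounded (B : set E) : Prop :=
  forall U, barrel U -> exists n : nat, B `<=` *:%R n%:R @` U.

Definition barrel_precompact (A : set E) : Prop :=
  forall U, barrel U ->
    exists2 F : set E, finite_set F & A `<=` [set f + u | f in F & u in U].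

End Barrels.

Definition beta_precompact (K : numFieldType) (X Y : tvsType K) (T : X -> Y) :
    Prop :=
  forall B : set X, barrel_bounded B -> barrel_precompact (T @` B).

Section Dual.
Context (K : numFieldType) (E : tvsType K).

Record dual := Dual {
  dual_fun :> {linear E -> K^o};
  dual_continuous : continuous dual_fun }.

HB.instance Definition _ := gen_eqMixin dual.
HB.instance Definition _ := gen_choiceMixin dual.

Definition weak_star_dual : Type :=
  initial_topology (fun chi : dual => (chi : E -> K^o) : {ptws E -> K^o}).
HB.instance Definition _ := Topological.on weak_star_dual.

Definition beta_star_dual : Type :=
  initial_topology
    (fun chi : dual =>
       (chi : E -> K^o) : {family @barrel_bounded K E, E -> K^o}).
HB.instance Definition _ := Topological.on beta_star_dual.

End Dual.

Definition sequentially_continuous (S T : topologicalType) (f : S -> T) :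
    Prop :=
  forall (u : nat -> S) (l : S),
    u n @[n --> \oo] --> l -> f (u n) @[n --> \oo] --> f l.

Definition JNP (K : numFieldType) (E : tvsType K) : Prop :=
  ~ sequentially_continuous
      (fun chi : weak_star_dual E => (chi : dual E) : beta_star_dual E).

Section PolarBase.
Context (K : numFieldType) (E : tvsType K).
Context (archiK : forall a : K, exists n : nat, `|a| <= n%:R).

Lemma barrel_scale_le (U : set E) (a b : K) : barrel U ->
  `|a| <= `|b| -> *:%R a @` U `<=` *:%R b @` U.
Proof.
move=> [_ _ [_ bU]] ab _ [x Ux <-].
have [b0|b0] := eqVneq b 0.
  by move: ab; rewrite b0 normr0 normr_le0 => /eqP ->; exists x.
exists ((b^-1 * a) *: x); last by rewrite scalerA mulrA divff// mul1r.
apply: bU; last by exists x.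
by rewrite normrM normfV ler_pdivrMl ?normr_gt0// mulr1.
Qed.

Lemma barrel_boundedU (A B : set E) :
  barrel_bounded A -> barrel_bounded B -> barrel_bounded (A `|` B).
Proof.
move=> bA bB U barU.
have [n An] := bA _ barU; have [m Bm] := bB _ barU.
exists (maxn n m) => x [/An|/Bm]; apply: barrel_scale_le => //;
  by rewrite !normr_nat ler_nat ?leq_maxl ?leq_maxr.
Qed.

Lemma barrel_boundedZ (a : K) (B : set E) :
  barrel_bounded B -> barrel_bounded ( *:%R a @` B).
Proof.
move=> bB U barU; have [n Bn] := bB _ barU.
have [m am] := archiK (a * n%:R).
exists m => _ [x Bx <-]; have [u Uu <-] := Bn _ Bx.
have: ( *:%R (a * n%:R) @` U) (a *: (n%:R *: u)) by exists u; rewrite ?scalerA.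
by apply: barrel_scale_le => //; rewrite (normr_nat K m).
Qed.

(* At chi = 0 the sets below are the polars of the barrel-bounded sets. *)
Lemma nbhs_beta_star (chi : beta_star_dual E) (P : set (beta_star_dual E)) :
  nbhs chi P <-> exists2 B : set E, barrel_bounded B &
    [set psi : dual E | forall x, B x -> `|psi x - (chi : dual E) x| <= 1]
      `<=` P.
Proof.
pose N (B : set E) : set (dual E) :=
  [set psi | forall x, B x -> `|psi x - (chi : dual E) x| <= 1].
pose G := filter_from (@barrel_bounded K E) N.
have GF : Filter G.
  apply: filter_from_filter; first by exists set0 => U _; exists 0%N => x [].
  move=> A B bA bB; exists (A `|` B); first exact: barrel_boundedU.
  by move=> psi h; split=> x xB; apply: h; [left|right].
split; last first.
  move=> [B bB] NP; apply: filterS NP _.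
  have := @fam_nbhs E K^o (@barrel_bounded K E) B
    [set xy : K^o * K^o | ball xy.1 1 xy.2] (chi : dual E).
  move=> /(_ (entourage_ball _ 1%:pos) bB) nB.
  have := @initial_continuous (dual E) _
    (fun psi : dual E =>
       (psi : E -> K^o) : {family @barrel_bounded K E, E -> K^o}) chi _ nB.
  apply: (@filterS _ _ (nbhs_filter chi)) => psi h x Bx; have := h x Bx.
  by rewrite -ball_normE /= distrC => /ltW.
move=> [_ [[W oW <-] Wchi] WP].
suff [B bB BW] : G (fun psi : dual E => W psi).
  by exists B => // psi /BW /WP.
have : nbhs ((chi : dual E) : {family @barrel_bounded K E, E -> K^o}) W.
  exact: open_nbhs_nbhs.
suff cvgG : {family @barrel_bounded K E,
    (fun psi : dual E => (psi : E -> K^o)) @ G --> ((chi : dual E) : E -> K^o)}.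
  by move=> /cvgG.
apply/fam_cvgP => A bA Q /uniform_nbhs[D [entD DQ]].
move: entD; rewrite -entourage_ballE => -[e /= e0 eD].
exists ( *:%R (2 / e) @` A); first exact: barrel_boundedZ.
move=> psi h; apply: DQ => y Ay; apply: eD => /=.
have /h : ( *:%R (2 / e) @` A) ((2 / e) *: y) by exists y.
have -> : psi ((2 / e) *: y) - (chi : dual E) ((2 / e) *: y) =
    (2 / e) * (psi y - (chi : dual E) y).
  by rewrite mulrBr; congr (_ - _); exact: linearZ.
rewrite normrM ger0_norm ?divr_ge0 ?(ltW e0)//.
rewrite -ball_normE /= distrC mulrAC ler_pdivrMr// mul1r => h2.
rewrite -(ltr_pM2l (ltr0Sn K 1)) (le_lt_trans h2)//.
by rewrite mulr_natl mulr2n ltrDl.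
Qed.

End PolarBase.

Section Cp0.
Context (K : numFieldType).

Definition tends_to0 : {pred nat -> K^o} :=
  fun f => `[< f n @[n --> \oo] --> (0 : K^o) >].

Lemma tends_to0_submod : submod_closed tends_to0.
Proof.
split; first by apply/asboolP; exact: cvg_cst.
move=> a f g /asboolP f0 /asboolP g0; apply/asboolP.
rewrite -[X in _ --> X](addr0 (0 : K^o)) -[X in _ --> X + _](scaler0 _ a).
by apply: cvgD => //; apply: cvgZr.
Qed.

HB.instance Definition _ :=
  GRing.isSubmodClosed.Build K (nat -> K^o) tends_to0 tends_to0_submod.

Record Cp0 := MkCp0 { Cp0_fun :> nat -> K^o; Cp0P : Cp0_fun \in tends_to0 }.

HB.instance Definition _ := [isSub for Cp0_fun].
HB.instance Definition _ := [Choice of Cp0 by <:].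
HB.instance Definition _ := [SubChoice_isSubLmodule of Cp0 by <:].
HB.instance Definition _ := Topological.copy Cp0
  (initial_topology (fun f : Cp0 => (f : nat -> K^o) : {ptws nat -> K^o})).

Lemma Cp0_cvgP (F : set_system Cp0) (f : Cp0) : Filter F ->
  F --> f <-> forall n, (g n : K^o) @[g --> F] --> (f n : K^o).
Proof.
move=> FF; split=> [Ff n|Ff].
  have /pointwise_cvgP : {ptws, (fun g : Cp0 => (g : nat -> K^o)) @ F
      --> (f : nat -> K^o)}.
    by move=> A /initial_continuous /Ff.
  by apply.
move=> P [_ [[W oW <-] Wf] WP]; apply: filterS WP _.
have : {ptws, (fun g : Cp0 => (g : nat -> K^o)) @ F --> (f : nat -> K^o)}.
  exact/pointwise_cvgP.
by apply; exact: open_nbhs_nbhs.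
Qed.

Lemma Cp0_eval_continuous n : continuous (fun f : Cp0 => f n : K^o).
Proof. by move=> f; have /Cp0_cvgP := @cvg_id _ (nbhs f); apply. Qed.

Lemma Cp0_add_continuous : continuous (fun x : Cp0 * Cp0 => x.1 + x.2).
Proof.
move=> [f g]; apply/Cp0_cvgP => n.
have fn : (fun x : Cp0 * Cp0 => x.1 n : K^o) @ (f, g) --> (f n : K^o).
  by apply: (continuous_cvg _ (@Cp0_eval_continuous n f)); exact: cvg_fst.
have gn : (fun x : Cp0 * Cp0 => x.2 n : K^o) @ (f, g) --> (g n : K^o).
  by apply: (continuous_cvg _ (@Cp0_eval_continuous n g)); exact: cvg_snd.
exact: (cvgD fn gn).
Qed.

Lemma Cp0_scale_continuous : continuous (fun z : K^o * Cp0 => z.1 *: z.2).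
Proof.
move=> [a g]; apply/Cp0_cvgP => n.
have an : (fun x : K^o * Cp0 => x.1 : K^o) @ (a, g) --> (a : K^o) by exact: cvg_fst.
have gn : (fun x : K^o * Cp0 => x.2 n : K^o) @ (a, g) --> (g n : K^o).
  by apply: (continuous_cvg _ (@Cp0_eval_continuous n g)); exact: cvg_snd.
exact: (@cvgZ K K^o _ _ _ _ _ _ _ an gn).
Qed.

Lemma Cp0_locally_convex :
  exists2 B : set_system Cp0, (forall b, b \in B -> convex_set b) & basis B.
Proof.
exists [set V | open V /\ convex_set V]; first by move=> b; rewrite inE => -[].
split=> [V []//|f].
have FF : Filter (filter_from
    [set V : set Cp0 | (open V /\ convex_set V) /\ V f] id).
  apply: filter_from_filter.
    exists setT; split=> //; split; first exact: openT.
    by move=> *; rewrite inE.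
  move=> A B [[oA cA] Af] [[oB cB] Bf]; exists (A `&` B) => //.
  split=> //; split; first exact: openI.
  move=> x y l; rewrite !inE => -[Ax Bx] [Ay By].
  split; apply/set_mem; [apply: cA|apply: cB]; exact/mem_set.
apply/Cp0_cvgP => n Q.
have [D Dconv [Dopen Dbasis]] := @locally_convex K K^o.
move=> /Dbasis[C [DC Cf] CQ].
exists ((fun g : Cp0 => g n : K^o) @^-1` C); last by move=> g /CQ.
split=> //; split.
  apply: open_comp; last exact: Dopen.
  by move=> g _; exact: Cp0_eval_continuous.
move=> x y l; rewrite !inE /= => Cx Cy; apply/set_mem.
by apply: (Dconv C _ (x n) (y n) l); exact/mem_set.
Qed.

HB.instance Definition _ := PreTopologicalLmod_isTvs.Build K Cp0
  Cp0_add_continuous Cp0_scale_continuous Cp0_locally_convex.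
HB.instance Definition _ :=
  PreTopologicalNmodule_isTopologicalNmodule.Build Cp0 Cp0_add_continuous.
HB.instance Definition _ :=
  TopologicalNmodule_isTopologicalLmodule.Build K Cp0 Cp0_scale_continuous.
HB.instance Definition _ := Uniform_isTvs.Build K Cp0 Cp0_locally_convex.

End Cp0.

(* Main.v *)
Require Import Defs.
From HB Require Import structures.
From mathcomp Require Import all_boot all_order all_algebra.
From mathcomp Require Import all_classical all_reals all_analysis.
From mathcomp Require Import complex zify.

Import Order.TTheory GRing.Theory Num.Theory.
Import numFieldNormedType.Exports.

Local Open Scope classical_set_scope.
Local Open Scope ring_scope.

(* If u_n -> l weak* but not uniformly on some barrel-bounded B, then
   x |-> ((u_n - l)(x))_n maps B to a set that no finite set translates into the
   barrel of sequences bounded by 1/2.  Conversely, the coordinate functionals of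
   an operator T form a weak*-null sequence; if it were beta*-null, then T(B)
   would be uniformly null and coordinatewise bounded, hence totally bounded in
   the sup norm, and every barrel of Cp0 contains a sup-norm ball. *)

(** * Finite nets in the discs of the scalar field *)

Lemma real_finite_net (R : realType) (k m : nat) :
  exists2 F : set R, finite_set F &
    forall x, `|x| <= k%:R -> exists2 y, F y & `|x - y| <= m.+1%:R^-1.
Proof.
pose F : set R := [set i%:R / m.+1%:R - k%:R | i in `I_((k + k) * m.+1).+1].
exists F; first exact/finite_image/finite_II.
move=> x; rewrite ler_norml => /andP[kx xk].
(* [t] measures [x] from [-k] in grid steps; its integer part is the index of the grid point just
   below [x]. *)
pose t := (x + k%:R) * m.+1%:R.
have t0 : 0 <= t by rewrite mulr_ge0// -lerBlDr sub0r.
have /andP[t1 t2] := truncn_itv t0.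
exists ((Num.truncn t)%:R / m.+1%:R - k%:R).
  exists (Num.truncn t) => //=; rewrite ltnS -(ler_nat R) (le_trans t1)//.
  by rewrite natrM ler_wpM2r// natrD lerD2r.
have -> : x - ((Num.truncn t)%:R / m.+1%:R - k%:R) =
    (t - (Num.truncn t)%:R) / m.+1%:R.
  by rewrite mulrBl mulfK ?pnatr_eq0// opprB addrA [in RHS]addrAC addrAC.
rewrite ger0_norm ?mulr_ge0 ?invr_ge0 ?subr_ge0//.
by rewrite ler_piMl ?invr_ge0// lerBlDr nat1r ltW.
Qed.

Lemma complex_finite_net (R : realType) (k m : nat) :
  exists2 F : set R[i], finite_set F &
    forall x, `|x| <= k%:R -> exists2 y, F y & `|x - y| <= m.+1%:R^-1.
Proof.
(* Since [(m + m.+1).+1 = 2 * m.+1], each of the two coordinates may err by half the tolerance. *)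
have [F finF FP] := real_finite_net R k (m + m.+1).
exists [set Complex a b | a in F & b in F]; first exact: finite_image2.
move=> [a b]; rewrite normc_def /= => abk.
have {abk} sk : Num.sqrt (a ^+ 2 + b ^+ 2) <= k%:R.
  by move: abk; rewrite -(rmorph_nat (real_complex R)) lecR.
have ak : `|a| <= k%:R.
  by apply: le_trans sk; rewrite -sqrtr_sqr ler_wsqrtr// lerDl sqr_ge0.
have bk : `|b| <= k%:R.
  by apply: le_trans sk; rewrite -sqrtr_sqr ler_wsqrtr// lerDr sqr_ge0.
have [a' Fa' aa'] := FP _ ak; have [b' Fb' bb'] := FP _ bk.
exists (Complex a' b'); first by exists a' => //; exists b'.
rewrite normc_def /=.
rewrite -(rmorph_nat (real_complex R)) -fmorphV lecR.
set e := (m + m.+1).+1%:R^-1 in aa' bb'.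
have -> : m.+1%:R^-1 = e + e :> R.
  rewrite /e -addSn -mulr2n -[(_ + _)%N]/(m.+1 + m.+1)%N addnn -muln2 natrM.
  by rewrite invfM -mulrnAr -[_ *+ 2]mulr_natr mulVf ?mulr1// pnatr_eq0.
have e0 : 0 <= e by rewrite invr_ge0.
rewrite -[leRHS]ger0_norm ?addr_ge0// -sqrtr_sqr ler_wsqrtr//.
rewrite -(real_normK (num_real (a - a'))) -(real_normK (num_real (b - b'))).
apply: (@le_trans _ _ (e ^+ 2 + e ^+ 2)).
  by rewrite lerD// lerXn2r// nnegrE.
by rewrite sqrrD addrAC lerDl mulrn_wge0// mulr_ge0.
Qed.

Section RealOrComplex.
Context (R : realType) (K : numFieldType).
Context (real_or_complex : K = (R : numFieldType) \/ K = (R[i] : numFieldType)).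

Lemma scalar_archimedean (a : K) : exists n : nat, `|a| <= n%:R.
Proof.
case: real_or_complex a => -> a.
  by exists (Num.bound `|a|); rewrite ltW// archi_boundP.
rewrite normc_def; set r := Num.sqrt _.
exists (Num.bound r); rewrite -(rmorph_nat (real_complex R)) lecR.
by rewrite ltW// archi_boundP ?sqrtr_ge0.
Qed.

Lemma scalar_finite_net (k m : nat) :
  exists2 F : set K, finite_set F &
    forall x, `|x| <= k%:R -> exists2 y, F y & `|x - y| <= m.+1%:R^-1.
Proof.
case: real_or_complex => ->; first exact: real_finite_net.
exact: complex_finite_net.
Qed.

End RealOrComplex.

(** * Elementary properties of barrels *)

Section BarrelTheory.
Context (K : numFieldType) (E : tvsType K).

Lemma barrel_midpoint (U : set E) (x y : E) :
  barrel U -> U x -> U y -> U (2^-1 *: (x + y)).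
Proof.
move=> [_ _ [cU _]] Ux Uy.
have h0 : 0 <= 2^-1 :> K by rewrite invr_ge0.
have h1 : 2^-1 <= 1 :> K by rewrite invf_le1// ler1n.
have := cU x y (Itv01 h0 h1) (mem_set Ux) (mem_set Uy).
move/set_mem; congr U; rewrite /conv /= scalerDr; congr (_ + _ *: _).
by rewrite /= /unstable.onem {1}(splitr 1) mul1r addrK.
Qed.

Lemma barrelZ (U : set E) (a : K) (x : E) :
  barrel U -> `|a| <= 1 -> U x -> U (a *: x).
Proof. by move=> [_ _ [_ bU]] a1 Ux; apply: (bU a a1); exists x. Qed.

Lemma barrel0 (U : set E) : barrel U -> U 0.
Proof.
move=> barU; have [_ /(_ 0)[r r0 /(_ r)]] := barU.
rewrite (ger0_norm (ltW r0)) => /(_ (lexx _))[x Ux _] _.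
by rewrite -(scale0r x); apply: barrelZ; rewrite ?normr0.
Qed.

(** Absorption read at [a^-1]: [x] lies in [a^-1 *: U] once [|a^-1|] reaches the absorption
    radius. *)
Lemma barrel_small_multiples (U : set E) (x : E) : barrel U ->
  (forall a : K, exists n : nat, `|a| <= n%:R) ->
  exists n : nat, forall a : K, `|a| <= n.+1%:R^-1 -> U (a *: x).
Proof.
move=> barU archiK; have [_ /(_ x)[r r0 rU] _] := barU.
have [n rn] := archiK r; exists n => a an.
have [->|a0] := eqVneq a 0; first by rewrite scale0r; exact: barrel0.
have [|u Uu <-] := rU a^-1; last by rewrite scalerA divff// scale1r.
rewrite normfV -[leLHS]invrK lef_pV2 ?posrE ?invr_gt0 ?normr_gt0//.
rewrite (le_trans an)// lef_pV2 ?posrE//.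
by rewrite (le_trans _ (le_trans rn _)) ?ler_nat// ger0_norm// ltW.
Qed.

End BarrelTheory.

Lemma closed_norm_le (K : numFieldType) (r : K) :
  closed [set z : K^o | `|z| <= r].
Proof.
move=> z clz /=.
(* The order is partial, so [r] may be incomparable with 0; unless [0 <= r] the set is empty. *)
have [r0|r0] := boolP (0 <= r); last first.
  have [|w [/= wr _]] := clz setT; first exact: filterT.
  by rewrite (le_trans (normr_ge0 w) wr) in r0.
rewrite real_leNgt ?ger0_real//; apply/negP => rz.
(* By the triangle inequality this ball misses the set. *)
have [|w [/= wr]] := clz (ball z (`|z| - r)).
  by apply: nbhsx_ballx; rewrite subr_gt0.
rewrite -ball_normE /= ltrBrDl => zw.
have : `|z| < `|z|.
  rewrite {1}(_ : z = w + (z - w)); last by rewrite addrC subrK.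
  apply: le_lt_trans (ler_normD _ _) (le_lt_trans _ zw); by rewrite lerD2r.
by rewrite ltxx.
Qed.

(** An intersection of preimages of discs is closed and absolutely convex; pointwise boundedness of
    the family makes it absorbent. *)
Lemma barrel_linear_forms (K : numFieldType) (E : tvsType K) (I : Type)
    (phi : I -> {linear E -> K^o}) (r : K) :
  0 < r -> (forall i, continuous (phi i)) ->
  (forall x, exists2 c : K, 0 < c & forall i, `|phi i x| <= c) ->
  barrel [set x | forall i, `|phi i x| <= r].
Proof.
move=> r0 phic phib; split; [|move=> x|split].
- have -> : [set x | forall i, `|phi i x| <= r] =
      \bigcap_i (phi i @^-1` [set z : K^o | `|z| <= r]).
    by apply/seteqP; split => [x h i _|x h i]; exact: h.
  apply: closed_bigI => i _; apply: preimage_closed; last exact: closed_norm_le.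
  by move=> x _; exact: phic.
- have [c c0 hc] := phib x; exists (c / r); first exact: divr_gt0.
  move=> a ca; have na0 : 0 < `|a| by rewrite (lt_le_trans _ ca)// divr_gt0.
  have a0 : a != 0 by rewrite -normr_gt0.
  exists (a^-1 *: x); last by rewrite scalerA divff// scale1r.
  move=> i /=; rewrite linearZ /= normrZ normfV ler_pdivrMl//.
  by rewrite (le_trans (hc i))// -ler_pdivrMr.
- move=> x y l; rewrite !inE /= => hx hy i.
  have l1 : 0 <= 1 - l%:num by rewrite subr_ge0.
  rewrite /conv /= linearD !linearZ /= (le_trans (ler_normD _ _))// !normrZ.
  rewrite (@ger0_norm _ l%:num)// /unstable.onem (ger0_norm l1).
  rewrite -[leRHS]mul1r -[X in X * r](subrKC l%:num) [leRHS]mulrDl.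
  by rewrite lerD// ler_wpM2l.
- move=> a a1 _ [x hx <-] i /=; rewrite linearZ /= normrZ.
  by rewrite (le_trans _ (hx i))// ler_piMl.
Qed.

(** * Barrels of [Cp0] and sup-norm balls *)

Section Cp0Barrels.
Context (K : numFieldType).
Context (archiK : forall a : K, exists n : nat, `|a| <= n%:R).

Definition Cp0_coord (n : nat) (f : Cp0 K) : K^o := f n.

Lemma Cp0_coord_linear n : linear (Cp0_coord n).
Proof. by []. Qed.

HB.instance Definition _ n :=
  GRing.isLinear.Build K (Cp0 K) K^o *:%R (Cp0_coord n) (Cp0_coord_linear n).

Lemma Cp0_coordZ (a : K) (f : Cp0 K) n : (a *: f) n = a * f n.
Proof. by []. Qed.

Lemma Cp0_truncation_subproof (N : nat) (f : nat -> K^o) :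
  (fun n => if (n < N)%N then f n else 0) \in @tends_to0 K.
Proof.
apply/asboolP; apply: cvg_near_cst.
by exists N => // n /= Nn; rewrite ltnNge Nn.
Qed.

Definition Cp0_truncation N f : Cp0 K := MkCp0 (Cp0_truncation_subproof N f).

Lemma Cp0_eventually_small (f : Cp0 K) (e : K) : 0 < e ->
  exists N, forall n, (N <= n)%N -> `|f n| <= e.
Proof.
move=> e0; have /asboolP/cvgr0Pnorm_le/(_ _ e0)[N _ hN] := Cp0P f.
by exists N => n; exact: hN.
Qed.

Lemma Cp0_bounded (f : Cp0 K) : exists2 c : K, 0 < c & forall n, `|f n| <= c.
Proof.
have [N fN] := Cp0_eventually_small f _ ltr01.
have s0 : 0 <= \sum_(i < N) `|f i| by exact: sumr_ge0.
(* The 1 bounds the tail from [N] on, the sum the first [N] coordinates. *)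
exists (1 + \sum_(i < N) `|f i|); first by rewrite ltr_pwDl.
move=> n; have [nN|Nn] := ltnP n N; last by rewrite (le_trans (fN n Nn))// lerDl.
rewrite (bigD1 (Ordinal nN))//= addrCA lerDl addr_ge0//.
exact: sumr_ge0.
Qed.

(** In the pointwise topology, points of [V] agreeing with [g] on ever longer initial segments would
    converge to [g]. *)
Lemma closed_Cp0_coord (V : set (Cp0 K)) (g : Cp0 K) : closed V -> ~ V g ->
  exists M, forall h : Cp0 K, (forall n, (n < M)%N -> h n = g n) -> ~ V h.
Proof.
move=> clV nVg; apply: contrapT => /forallNP nM.
have /choice[h hP] M : exists h : Cp0 K,
    (forall n, (n < M)%N -> h n = g n) /\ V h.
  have /existsNP[h /not_implyP[hg /contrapT Vh]] := nM M.
  by exists h.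
apply: nVg; apply: (@closed_cvg _ _ \oo _ h V clV).
  by apply: nearW => M; exact: (hP M).2.
apply/Cp0_cvgP => n; apply: cvg_near_cst.
by exists n.+1 => // M /= nM'; exact: (hP M).1.
Qed.

(* A gliding hump: otherwise one adds finitely supported blocks with disjoint
   supports and heights tending to 0 so that the k-th partial sum, and anything
   sharing its first coordinates, lies outside k U; no multiple of U then
   contains the sum of all blocks. *)
Lemma barrel_contains_tail_ball (U : set (Cp0 K)) : barrel U ->
  exists N m : nat, forall f : Cp0 K, (forall n, (n < N)%N -> f n = 0) ->
    (forall n, `|f n| <= m.+1%:R^-1) -> U f.
Proof.
move=> barU; have [clU absU _] := barU.
apply: contrapT => nU.
have big N m : exists f : Cp0 K, [/\ forall n, (n < N)%N -> f n = 0,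
    forall n, `|f n| <= m.+1%:R^-1 & ~ U f].
  apply: contrapT => nf; apply: nU; exists N, m => f f0 fm.
  by apply: contrapT => nUf; apply: nf; exists f.
pose supp (q : Cp0 K * nat) := forall n, (q.2 <= n)%N -> q.1 n = 0.
(* A state is a stage [k] with a partial sum and a bound for its support. The premise [supp p.2]
   sits under the existential so that [choice] yields a total successor function. *)
have step (p : nat * (Cp0 K * nat)) : exists q : Cp0 K * nat, supp p.2 ->
    [/\ supp q, (p.2.2 < q.2)%N,
      forall n, (n < p.2.2)%N -> q.1 n = p.2.1 n,
      forall n, (p.2.2 <= n)%N -> `|q.1 n| <= p.1.+1%:R^-1 &
      forall h : Cp0 K, (forall n, (n < q.2)%N -> h n = q.1 n) ->
        ~ U (p.1.+1%:R^-1 *: h)].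
  case: p => k [s N] /=; rewrite /supp /=.
  set a : K := k.+1%:R; have a0 : a != 0 by rewrite pnatr_eq0.
  (* With [a = k.+1], heights below [1 / (2 * a ^ 2)] leave the block [(2 * a) *: g] of height at
     most [1 / a]. *)
  have [g' [g'0 g'm nUg']] := big N (2 * k.+1 * k.+1)%N.
  have [M1 hM1] := closed_Cp0_coord _ _ clU nUg'.
  pose g := Cp0_truncation M1 g'.
  have nUg : ~ U g by apply: hM1 => n nM /=; rewrite nM.
  have gN n : (n < N)%N -> g n = 0 by move=> /g'0 /= ->; rewrite if_same.
  have gM1 n : (M1 <= n)%N -> g n = 0 by rewrite /= ltnNge => ->.
  have gm n : `|2 * a * g n| <= a^-1.
    rewrite normrM ger0_norm ?mulr_ge0// -ler_pdivlMl ?mulr_gt0 ?ltr0n//.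
    have -> : (2 * a)^-1 / a = (2 * k.+1 * k.+1)%:R^-1.
      by rewrite !natrM !invfM.
    apply: (@le_trans _ _ (2 * k.+1 * k.+1).+1%:R^-1).
      by rewrite /=; case: ifP => _ //; rewrite normr0 invr_ge0.
    by rewrite lef_pV2 ?posrE ?ltr0n// ler_nat.
  (* Adding the block or not: if both choices gave points of [U], then [g] would be the midpoint of
     [- a^-1 *: s] and [a^-1 *: (s + (2 * a) *: g)], hence in [U]. *)
  have [b bP] : exists b : bool, ~ U (a^-1 *: (s + b%:R *: ((2 * a) *: g))).
    apply: contrapT => /forallNP nb; apply: nUg.
    have /contrapT Us := nb false; have /contrapT Us' := nb true.
    have -> : g = 2^-1 *: (-1 *: (a^-1 *: s) + a^-1 *: (s + (2 * a) *: g)).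
      rewrite [a^-1 *: (s + _)]scalerDr scaleN1r addKr !scalerA -invfM.
      by rewrite mulVf ?scale1r// mulf_neq0 ?pnatr_eq0.
    apply: barrel_midpoint => //; last by rewrite scale1r in Us'.
    apply: barrelZ; rewrite ?normrN ?normr1//.
    by rewrite scale0r addr0 in Us.
  set s' := s + _ in bP.
  have s'E n : s' n = s n + b%:R * (2 * a * g n) by [].
  clearbody s'.
  have [M2 hM2] := closed_Cp0_coord _ _ clU bP.
  (* [N.+1] forces strict growth, [M1] covers the support of the block, and [M2] coordinates suffice
     to keep [a^-1 *: s'] outside [U]. *)
  exists (s', maxn N.+1 (maxn M1 M2)) => s0; split => /=.
  - move=> n; rewrite !geq_max s'E => /andP[Nn /andP[M1n _]].
    by rewrite s0 ?(ltnW Nn)// gM1// !mulr0 addr0.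
  - by rewrite leq_max leqnn.
  - by move=> n nN; rewrite s'E gN// !mulr0 addr0.
  - move=> n Nn; rewrite s'E s0// add0r; case: b {bP s' s'E hM2}.
      by rewrite mulr1n mul1r.
    by rewrite mulr0n mul0r normr0 invr_ge0.
  - move=> h hs'; apply: hM2 => n nM2.
    by rewrite !Cp0_coordZ hs'// !leq_max nM2 !orbT.
have /choice[F FP] := step.
pose q := fix q k := if k is k'.+1 then F (k', q k') else (0, 0%N).
have suppq k : supp (q k).
  by elim: k => [n _ //|k IH]; have [] := FP (k, q k) IH.
have qP k : [/\ ((q k).2 < (q k.+1).2)%N,
    forall n, (n < (q k).2)%N -> (q k.+1).1 n = (q k).1 n,
    forall n, ((q k).2 <= n)%N -> `|(q k.+1).1 n| <= k.+1%:R^-1 &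
    forall h : Cp0 K, (forall n, (n < (q k.+1).2)%N -> h n = (q k.+1).1 n) ->
      ~ U (k.+1%:R^-1 *: h)].
  by have [] := FP (k, q k) (suppq k).
clearbody q.
have qN k : (k <= (q k).2)%N.
  elim: k => // k IH; apply: leq_ltn_trans IH _.
  by have [] := qP k.
have qle k i : ((q k).2 <= (q (k + i)%N).2)%N.
  elim: i => [|i IH]; first by rewrite addn0.
  rewrite addnS (leq_trans IH)// ltnW//.
  by have [] := qP (k + i)%N.
have qE k i n : (n < (q k).2)%N -> (q (k + i)%N).1 n = (q k).1 n.
  move=> nk; elim: i => [|i IH]; first by rewrite addn0.
  rewrite addnS -IH; have [_ + _ _] := qP (k + i)%N.
  by apply; exact: leq_trans nk (qle _ _).
have qsmall k i n : ((q k).2 <= n)%N -> `|(q (k + i)%N).1 n| <= k.+1%:R^-1.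
  move=> kn; elim: i => [|i IH]; first by rewrite addn0 suppq// normr0 invr_ge0.
  have [_ lo hi _] := qP (k + i)%N.
  rewrite addnS; have [n1|n1] := ltnP n (q (k + i)%N).2.
    by rewrite lo.
  rewrite (le_trans (hi _ n1))// lef_pV2 ?posrE ?ltr0n// ler_nat ltnS.
  exact: leq_addr.
(* The support bound at stage [n.+1] exceeds [n], so coordinate [n] is final there and the diagonal
   is the sum of all blocks. It tends to 0 by [qsmall]. *)
have h0 : (fun n => (q n.+1).1 n : K^o) \in @tends_to0 K.
  apply/asboolP/cvgr0Pnorm_le => e e0.
  have [k ek] := archiK e^-1.
  exists (q k).2 => // n /= kn.
  have kn1 : (k <= n.+1)%N by rewrite ltnW// ltnS (leq_trans (qN k)).
  rewrite -(subnKC kn1) (le_trans (qsmall _ _ _ kn))// -[leRHS]invrK.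
  rewrite lef_pV2 ?posrE ?invr_gt0//.
  by rewrite (le_trans _ (le_trans ek _)) ?ler_nat// ger0_norm// invr_ge0 ltW.
pose h : Cp0 K := MkCp0 h0.
have hE k n : (n < (q k).2)%N -> h n = (q k).1 n.
  move=> nk /=; have [kn|nk'] := leqP k n.+1.
    by rewrite -(subnKC kn) qE.
  by rewrite -(subnKC (ltnW nk')) qE.
(* Absorption puts [h] in [k.+1%:R *: U], while [h] shares the coordinates that keep stage [k.+1]
   out of it. *)
have [r r0 rU] := absU h; have [k rk] := archiK r.
have [_ _ _ /(_ h (hE k.+1))] := qP k; apply.
have /rU[u Uu <-] : r <= `|k.+1%:R : K|.
  rewrite normr_nat (le_trans (le_trans _ rk)) ?ler_nat//.
  by rewrite real_ler_norm ?gtr0_real.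
by rewrite scalerA mulVf ?scale1r// pnatr_eq0.
Qed.

(** The vanishing condition of the tail ball is removed one coordinate at a time: [f] is the
    midpoint of a small multiple of a unit vector and of twice the remainder, which vanishes at one
    more place. *)
Lemma barrel_contains_ball (U : set (Cp0 K)) : barrel U ->
  exists m : nat, forall f : Cp0 K, (forall n, `|f n| <= m.+1%:R^-1) -> U f.
Proof.
move=> barU; have [N [m mU]] := barrel_contains_tail_ball _ barU.
elim: N m mU => [|N IH] m mU; first by exists m => f; exact: mU.
pose e : Cp0 K := Cp0_truncation N.+1 (fun n => (n == N)%:R).
have eE n : e n = (n == N)%:R.
  by rewrite /= ltnS leq_eqVlt; case: eqVneq => //= _; rewrite if_same.
have [k kU] := barrel_small_multiples K _ U (2 *: e) barU archiK.
(* The new radius is at most [1 / k.+1], for the unit-vector term, and at most [1 / (2 * m.+1)], so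
   that the doubled remainder stays in the old ball. *)
apply: (IH (k + (m + m).+1)%N) => f f0 fm.
have -> : f = 2^-1 *: (f N *: (2 *: e) + 2 *: (f - f N *: e)).
  rewrite [f N *: (2 *: e)]scalerA mulrC -scalerA -scalerDr addrC subrK.
  by rewrite scalerA mulVf ?scale1r// pnatr_eq0.
apply: barrel_midpoint => //.
  apply: kU; rewrite (le_trans (fm N))// lef_pV2 ?posrE ?ltr0n// ler_nat.
  by rewrite ltnS leq_addr.
have coordE n : (2 *: (f - f N *: e)) n = 2 * (f n - f N * e n) by [].
apply: mU => n; rewrite coordE eE.
  rewrite ltnS leq_eqVlt => /predU1P[->|nN].
    by rewrite eqxx mulr1 subrr mulr0.
  by rewrite f0// ltn_eqF// mulr0 subrr mulr0.
have [->|_] := eqVneq n N.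
  by rewrite mulr1 subrr mulr0 normr0 invr_ge0.
rewrite mulr0 subr0 normrM normr_nat -ler_pdivlMl//.
rewrite (le_trans (fm n))// -invfM lef_pV2 ?posrE ?mulr_gt0 ?ltr0n//.
by rewrite -natrM ler_nat mul2n -addnn; lia.
Qed.

Context (netK : forall k m : nat, exists2 F : set K, finite_set F &
  forall x, `|x| <= k%:R -> exists2 y, F y & `|x - y| <= m.+1%:R^-1).

(** Take a sup-norm ball inside the barrel. Beyond some [N] all of [A] is that small, so 0
    approximates the tails; the first [N] coordinates are bounded and get a product of finite scalar
    nets, built by induction on [N]. *)
Lemma uniformly_null_barrel_precompact (A : set (Cp0 K)) :
  (forall n, exists k : nat, forall f, A f -> `|f n| <= k%:R) ->
  (forall m : nat, exists N, forall f, A f ->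
    forall n, (N <= n)%N -> `|f n| <= m.+1%:R^-1) ->
  barrel_precompact A.
Proof.
move=> Ab An U barU; have [m mU] := barrel_contains_ball _ barU.
have [N AN] := An m.
suff [F finF FP] : exists2 F : set (Cp0 K), finite_set F & forall f, A f ->
    exists2 y, F y & (forall n, (n < N)%N -> `|f n - y n| <= m.+1%:R^-1) /\
      (forall n, (N <= n)%N -> y n = 0).
  exists F => // f Af; have [y Fy [yN y0]] := FP f Af.
  exists y => //; exists (f - y); last by rewrite addrC subrK.
  apply: mU => n; rewrite -[(f - y) n]/(f n - y n).
  by have [nN|Nn] := ltnP n N; [exact: yN|rewrite y0// subr0; exact: AN].
elim: N {AN} => [|N [F finF FP]].
  by exists [set 0]; [exact: finite_set1|move=> f _; exists 0].
have [k kA] := Ab N; have [G finG GP] := netK k m.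
pose add (y : Cp0 K) (c : K) :=
  Cp0_truncation N.+1 (fun n => if n == N then c else y n).
exists [set add y c | y in F & c in G]; first exact: finite_image2.
move=> f Af; have [y Fy [yN y0]] := FP f Af; have [c Gc fc] := GP _ (kA f Af).
exists (add y c); first by exists y => //; exists c.
split=> n; last by move=> Nn /=; rewrite ltnNge Nn.
rewrite ltnS leq_eqVlt => /predU1P[->|nN] /=; first by rewrite ltnSn eqxx.
by rewrite ltnS ltnW// ltn_eqF//; exact: yN.
Qed.

End Cp0Barrels.

(** * Sequential convergence in the two dual topologies *)

Lemma weak_star_cvgP (K : numFieldType) (E : tvsType K)
    (u : nat -> weak_star_dual E) (l : weak_star_dual E) :
  u n @[n --> \oo] --> l <->
  forall x, ((u n : dual E) x : K^o) @[n --> \oo] --> ((l : dual E) x : K^o).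
Proof.
pose val (chi : weak_star_dual E) := (chi : dual E) : E -> K^o.
have ptwsP : {ptws, val (u n) @[n --> \oo] --> val l} <->
    forall x, (val (u n) x : K^o) @[n --> \oo] --> (val l x : K^o).
  exact: pointwise_cvgP.
split=> [ul|ul].
  by apply/ptwsP => A /initial_continuous /ul.
move=> P [_ [[W oW <-] Wl] WP]; apply: filterS WP _.
apply: (ptwsP.2 ul W); exact: open_nbhs_nbhs.
Qed.

Section JosefsonNissenzweig.
Context (K : numFieldType) (E : tvsType K).
Context (archiK : forall a : K, exists n : nat, `|a| <= n%:R).

Lemma beta_star_cvgP (u : nat -> beta_star_dual E) (l : beta_star_dual E) :
  u n @[n --> \oo] --> l <->
  forall B : set E, barrel_bounded B -> \forall n \near \oo,
    forall x, B x -> `|(u n : dual E) x - (l : dual E) x| <= 1.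
Proof.
split=> [ul B bB|ul P /(nbhs_beta_star archiK)[B bB BP]].
  apply: (ul [set psi : dual E |
    forall x, B x -> `|psi x - (l : dual E) x| <= 1]).
  by apply/(nbhs_beta_star archiK); exists B.
by apply: filterS (ul B bB) => n; exact: BP.
Qed.

(** * Null sequences of functionals and operators into [Cp0] *)

Definition Cp0_of_null_sequence (phi : nat -> E -> K^o)
  (phi0 : forall x, phi n x @[n --> \oo] --> (0 : K^o)) (x : E) : Cp0 K :=
  MkCp0 (introT (asboolP _) (phi0 x)).

Lemma JNP_operator : JNP E ->
  exists T : {linear E -> Cp0 K}, continuous T /\ ~ beta_precompact T.
Proof.
move=> /existsNP[u /existsNP[l /not_implyP[/weak_star_cvgP ul nul]]].
have [B [bB nB]] : exists B : set E, barrel_bounded B /\ ~ \forall n \near \oo,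
    forall x, B x -> `|(u n : dual E) x - (l : dual E) x| <= 1.
  apply: contrapT => nB; apply: nul; apply/beta_star_cvgP => B bB.
  by apply: contrapT => nBu; apply: nB; exists B.
pose phi n x : K^o := (u n : dual E) x - (l : dual E) x.
have phi0 x : phi n x @[n --> \oo] --> (0 : K^o).
  by rewrite -(subrr ((l : dual E) x)); apply: cvgB (ul x) _; exact: cvg_cst.
have phiL n : linear (phi n).
  move=> a x y; rewrite /phi (linearP (dual_fun (u n))).
  by rewrite (linearP (dual_fun l)) scalerBr opprD addrACA.
have phic n : continuous (phi n).
  by move=> x; apply: cvgB; exact: dual_continuous.
pose T := Cp0_of_null_sequence phi phi0.
have TL : linear T.
  by move=> a x y; apply: val_inj; apply/funext => n; exact: phiL.
pose Tlin := GRing.isLinear.Build K E (Cp0 K) *:%R T TL.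
pose TT : {linear E -> Cp0 K} := HB.pack T Tlin.
exists TT; split; first by move=> x; apply/Cp0_cvgP => n; exact: phic.
move=> pT; apply: nB.
have half0 : 0 < 2^-1 :> K by rewrite invr_gt0.
have barU : barrel [set f : Cp0 K | forall n, `|Cp0_coord K n f| <= 2^-1].
  apply: barrel_linear_forms => // [n|f]; first exact: Cp0_eval_continuous.
  exact: Cp0_bounded.
have [F finF TF] := pT B bB _ barU.
(* Finitely many null sequences are uniformly small beyond a common [N]; with the barrel of radius
   1/2 this bounds [phi n] by 1 on all of [B], contradicting the choice of [B]. *)
have [N FN] : exists N, forall f, F f -> forall n, (N <= n)%N -> `|f n| <= 2^-1.
  have /choice[bnd bndP] f := Cp0_eventually_small K f _ half0.
  have /finite_seqP[s ->] := finF.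
  exists (\max_(f <- s) bnd f)%N => f fs n fn; apply: bndP.
  by apply: leq_trans fn; exact: leq_bigmax_seq.
exists N => // n /= Nn x Bx.
have [f Ff [g Ug fgx]] : [set f + g | f in F &
    g in [set g : Cp0 K | forall n, `|Cp0_coord K n g| <= 2^-1]] (T x).
  by apply: TF; exists x.
rewrite -[X in `|X|]/(T x n) -fgx.
rewrite -[(f + g) n]/(f n + g n) (le_trans (ler_normD _ _))// [leRHS]splitr.
by rewrite mul1r lerD ?(FN f Ff)//; exact: Ug.
Qed.

Context (netK : forall k m : nat, exists2 F : set K, finite_set F &
  forall x, `|x| <= k%:R -> exists2 y, F y & `|x - y| <= m.+1%:R^-1).

(** The set where [|phi|] is at most 1 is itself a barrel, so a multiple of it contains [B]. *)
Lemma barrel_bounded_form (phi : {linear E -> K^o}) (B : set E) :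
  continuous phi -> barrel_bounded B ->
  exists k : nat, forall x, B x -> `|phi x| <= k%:R.
Proof.
move=> phic bB.
have barU : barrel [set x | forall i : unit, `|phi x| <= 1].
  apply: (barrel_linear_forms K E unit (fun=> phi)) => // x.
  by exists (1 + `|phi x|) => [|_]; rewrite ?ltr_pwDl// lerDr.
have [k Bk] := bB _ barU; exists k => x /Bk[y /(_ tt) y1 <-].
by rewrite linearZ normrZ normr_nat ler_piMr.
Qed.

Lemma operator_JNP (T : {linear E -> Cp0 K}) :
  continuous T -> ~ beta_precompact T -> JNP E.
Proof.
move=> Tc nT seqc; apply: nT => B bB.
pose coordT n : {linear E -> K^o} := Cp0_coord K n \o T.
have coordTc n : continuous (coordT n).
  by move=> x; apply: (continuous_comp (Tc x)); exact: Cp0_eval_continuous.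
pose zero : {linear E -> K^o} := \0.
have zeroc : continuous zero by move=> x; exact: cvg_cst.
pose u n : weak_star_dual E := Dual (coordTc n).
have /seqc/beta_star_cvgP ul : u n @[n --> \oo] --> (Dual zeroc : weak_star_dual E).
  (* Pointwise convergence of the coordinate functionals to 0 is the membership of [T x] in
     [Cp0]. *)
  apply/weak_star_cvgP => x; exact/asboolP/Cp0P.
apply: uniformly_null_barrel_precompact => // [n|m].
  have [k hk] := barrel_bounded_form (coordT n) B (coordTc n) bB.
  by exists k => _ [x Bx <-]; exact: hk.
(* A bound 1 on the dilate [m.+1%:R *: B] is the bound [1 / m.+1] on [B]. *)
have [N _ hN] := ul _ (barrel_boundedZ archiK m.+1%:R bB).
exists N => _ [x Bx <-] n Nn.
have /(_ (m.+1%:R *: x)) := hN n Nn.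
rewrite /= subr0 linearZ normrZ normr_nat => h.
by rewrite -[leRHS]mulr1 ler_pdivlMl ?ltr0n//; apply: h; exists x.
Qed.

End JosefsonNissenzweig.

Theorem theorem2p5 (R : realType) (K : numFieldType)
    (K_real_or_complex : K = (R : numFieldType) \/ K = (R[i] : numFieldType))
    (E : tvsType K)
    (E_hausdorff : hausdorff_space E)
    (E_infinite_dimensional : ~ finite_dimensional E) :
  JNP E <->
  exists T : {linear E -> Cp0 K}, continuous T /\ ~ beta_precompact T.
Proof.
(* The choice of field enters through these two facts: it is archimedean and its discs are totally
   bounded. *)
have archiK := scalar_archimedean R K K_real_or_complex.
have netK := scalar_finite_net R K K_real_or_complex.
split; first exact: JNP_operator.
by move=> [T [Tc nT]]; exact: operator_JNP nT.
Qed.
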